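(* There are infinitely many pairwise non-isomorphic connected bipartite graphs $G$ that are not trees and satisfy $$a(G)-\alpha(G)=2+\mu(G)-2\sqrt{1+\mu(G)}.$$
   Context: All graphs are finite, simple and undirected. For a graph $G$, $m(G)$ is the number of edges, $\alpha(G)$ is the independence number, and $\mu(G)$ is the matching number. If $d_1\leq\cdots\leq d_n$ is the degree sequence of $G$, the annihilation number is $a(G)=\max\{k : \sum_{i=1}^k d_i\leq m(G)\}$. *)

(* Defs.v *)
From mathcomp Require Import all_boot.

Set Implicit Arguments.
Unset Strict Implicit.
Unset Printing Implicit Defensive.

Record sgraph := SGraph {
  vertex :> finType;
  adj : rel vertex;
  adj_sym : symmetric adj;
  adj_irr : irreflexive adj
}.

Section GraphNotions.

Variable G : sgraph.

Definition edges : {set {set G}} :=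
  [set e | [exists x : G, exists y : G, adj x y && (e == [set x; y])]].

Definition num_edges : nat := #|edges|.

Definition deg (x : G) : nat := #|[set y | adj x y]|.

Definition degree_sequence : seq nat := sort leq [seq deg x | x : G].

(* Indices are shifted: d_1, ..., d_k are the entries 0, ..., k - 1.  The
   range of k is 0 <= k <= n, and k = 0 always qualifies. *)
Definition annihilation_number : nat :=
  \max_(k < #|G|.+1 |
        \sum_(i < k) nth 0 degree_sequence i <= num_edges) k.

Definition independent (A : {set G}) : bool :=
  [forall x in A, forall y in A, ~~ adj x y].

Definition independence_number : nat :=
  \max_(A : {set G} | independent A) #|A|.

Definition matching (M : {set {set G}}) : bool :=
  (M \subset edges) && trivIset M.

Definition matching_number : nat :=
  \max_(M : {set {set G}} | matching M) #|M|.

(* The graph without vertices is not connected. *)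
Definition connected : Prop :=
  0 < #|G| /\ forall x y : G, connect (@adj G) x y.

Definition bipartite : Prop :=
  exists A : {set G}, forall x y : G, adj x y -> (x \in A) != (y \in A).

(* The size condition is needed since [:: x; y] is a ucycle for every edge. *)
Definition acyclic : Prop :=
  forall c : seq G, 2 < size c -> ~ ucycle (@adj G) c.

Definition is_tree : Prop := connected /\ acyclic.

End GraphNotions.

Definition isomorphic (G H : sgraph) : Prop :=
  exists2 f : G -> H, bijective f & forall x y : G, adj (f x) (f y) = adj x y.

(* Main.v *)
(* Attach [s] leaves to each vertex of the left side of [K_{s,s}], then one
   further leaf to every vertex.  The last leaves give a perfect matching with
   [s^2 + 2s] edges and are a maximum independent set, so [mu = alpha = s^2 + 2s].
   The [2s] vertices of [K_{s,s}] have the largest degrees and, because the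
   [s^2] edges of [K_{s,s}] counted twice balance the [s^2] matching edges that
   avoid it, their degrees sum to exactly [m]; hence the remaining degrees also
   sum to [m] and [a = n - 2s = 2s^2 + 2s].  Then [a - alpha = s^2], which is the
   required value since [1 + mu = (s + 1)^2]. *)
Require Import Defs.
From mathcomp Require Import all_boot all_order all_algebra.
From mathcomp Require Import zify ring.

Set Implicit Arguments.
Unset Strict Implicit.
Unset Printing Implicit Defensive.

Import Order.TTheory GRing.Theory Num.Theory.

(** * Sequences and images over sum types *)

Lemma sorted_nseq_cat n x (t : seq nat) :
  all (leq x) t -> sorted leq t -> sorted leq (nseq n x ++ t).
Proof.
move=> x_t t_sorted; elim: n => //= n IHn.
by rewrite (path_sortedE leq_trans) all_cat all_nseq leqnn orbT x_t.
Qed.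

Lemma map_enum_sum (S T : finType) (A : Type) (f : S + T -> A) :
  [seq f u | u : S + T] = [seq f (inl x) | x : S] ++ [seq f (inr y) | y : T].
Proof. by rewrite /image_mem !enumT [in LHS]unlock map_cat -!map_comp -!enumT. Qed.

Lemma image_const (T : finType) (A : Type) (f : T -> A) (a : A) :
  (forall x, f x = a) -> [seq f x | x : T] = nseq #|T| a.
Proof. by move=> fa; rewrite cardE /image_mem; elim: (enum _) => //= x l ->; rewrite fa. Qed.

(** * Double counting, matchings and annihilation number in any graph *)

Section Generalities.

Variable G : sgraph.

Lemma edgeP (e : {set G}) :
  reflect (exists x y : G, adj x y /\ e = [set x; y]) (e \in edges G).
Proof.
rewrite inE; apply: (iffP existsP) => [[x /existsP[y /andP[xy /eqP ->]]]|].
  by exists x, y.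
by case=> x [y [xy ->]]; exists x; apply/existsP; exists y; rewrite xy eqxx.
Qed.

Lemma adj_neq (x y : G) : adj x y -> x != y.
Proof. by move=> xy; apply: contraTneq xy => ->; rewrite adj_irr. Qed.

Lemma card_edge (e : {set G}) : e \in edges G -> #|e| = 2.
Proof. by case/edgeP=> x [y [/adj_neq xy ->]]; rewrite cards2 xy. Qed.

Lemma deg_sum (x : G) : deg x = \sum_(y : G) adj x y.
Proof. by rewrite /deg -sum1dep_card big_mkcond; apply: eq_bigr => y _; case: adj. Qed.

(** The map sending a neighbour [y] to [[set x; y]] is a bijection onto the edges at [x]. *)
Lemma deg_incident (x : G) : deg x = #|[set e in edges G | x \in e]|.
Proof.
rewrite /deg -(@card_in_imset _ _ (fun y => [set x; y])); last first.
  move=> y z; rewrite !inE => xy xz /setP/(_ y); rewrite !inE eqxx orbT.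
  by rewrite eq_sym (negPf (adj_neq xy)) => /esym/eqP.
congr #|pred_of_set _|; apply/setP=> e; rewrite [RHS]inE; apply/imsetP/andP.
  case=> y; rewrite inE => xy ->; split; last by rewrite set21.
  by apply/edgeP; exists x, y.
case=> /edgeP[u [v [uv ->]]]; rewrite !inE => /orP[]/eqP->.
  by exists v; rewrite ?inE.
by exists u; [rewrite inE adj_sym | rewrite setUC].
Qed.

Lemma handshake : \sum_(x : G) deg x = (num_edges G).*2.
Proof.
under eq_bigr => x _ do rewrite deg_incident -sum1dep_card big_mkcondr /=.
rewrite exchange_big /= -muln2 -sum_nat_const.
by apply: eq_bigr => e /card_edge <-; rewrite -big_mkcond sum1_card.
Qed.

(** The edges of a matching are disjoint pairs, so they cover twice as many vertices as there are
    edges. *)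
Lemma double_matching_number : (matching_number G).*2 <= #|G|.
Proof.
rewrite -geq_half_double /matching_number; apply/bigmax_leqP => M.
case/andP=> /subsetP ME /eqP tM; rewrite geq_half_double -muln2 -sum_nat_const.
apply: leq_trans (max_card (cover M)).
by rewrite -tM; apply: leq_sum => e /ME/card_edge ->.
Qed.

(** Since [d] already makes the sum exceed the number of edges, no prefix longer than [s]
    qualifies. *)
Lemma annihilation_number_split (s t : seq nat) d :
  sorted leq (s ++ d :: t) -> perm_eq [seq deg x | x : G] (s ++ d :: t) ->
  sumn s <= num_edges G < sumn s + d -> annihilation_number G = size s.
Proof.
move=> st_sorted st_perm /andP[s_le s_lt].
have degE : degree_sequence G = s ++ d :: t.
  apply: (sorted_eq leq_trans anti_leq) => //.
    by apply: sort_sorted; apply: leq_total.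
  by rewrite perm_sort.
have sizeG : #|G| = size (s ++ d :: t) by rewrite -(perm_size st_perm) size_map cardE.
have sumE k : k <= #|G| ->
    \sum_(i < k) nth 0 (s ++ d :: t) i = sumn (take k (s ++ d :: t)).
  move=> k_le; rewrite sumnE (big_nth 0) size_takel -?sizeG // big_mkord.
  by apply: eq_bigr => i _; rewrite nth_take.
rewrite /annihilation_number degE; apply/eqP; rewrite eqn_leq; apply/andP; split.
  apply/bigmax_leqP => -[k /= k_lt]; rewrite sumE //.
  apply: contraTT; rewrite -!ltnNge => s_k.
  rewrite take_cat (leq_gtF (ltnW s_k)) /= sumn_cat.
  apply: leq_trans s_lt _; rewrite leq_add2l.
  (* As [k] exceeds [size s], the part taken beyond [s] begins with [d]. *)
  by case: (k - size s) (subn_gt0 (size s) k) => [|j] /=; rewrite ?s_k // leq_addr.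
have s_ltG : size s < #|G|.+1 by rewrite sizeG size_cat ltnS leq_addr.
apply: (leq_bigmax_cond (Ordinal s_ltG)) => /=.
by rewrite sumE // take_size_cat.
Qed.

End Generalities.

Lemma isomorphic_card (G H : sgraph) : isomorphic G H -> #|G| = #|H|.
Proof. by case=> f /bij_eq_card. Qed.

(** * The corona: one new leaf at every vertex *)

Section Corona.

Variable C : sgraph.

(* [inl x] is the vertex [x] of [C], [inr x] the leaf attached to it. *)
Definition corona_adj (u v : C + C) : bool :=
  match u, v with
  | inl x, inl y => adj x y
  | inl x, inr y | inr x, inl y => x == y
  | inr _, inr _ => false
  end.

Lemma corona_adj_sym : symmetric corona_adj.
Proof. by move=> [x|x] [y|y] //=; rewrite 1?adj_sym // eq_sym. Qed.

Lemma corona_adj_irr : irreflexive corona_adj.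
Proof. by move=> [x|x] //=; rewrite adj_irr. Qed.

Definition corona : sgraph := SGraph corona_adj_sym corona_adj_irr.

Lemma card_corona : #|corona| = #|C|.*2.
Proof. by rewrite card_sum addnn. Qed.

Lemma deg_corona_inl (x : C) : deg (inl x : corona) = (deg x).+1.
Proof.
rewrite !deg_sum big_sumType /= -addn1; congr (_ + _).
by rewrite (bigD1 x) //= eqxx big1 // => y /negPf; rewrite eq_sym => ->.
Qed.

Lemma deg_corona_inr (x : C) : deg (inr x : corona) = 1.
Proof.
rewrite deg_sum big_sumType /= [X in _ + X]big1 // addn0.
by rewrite (bigD1 x) //= eqxx big1 // => y /negPf; rewrite eq_sym => ->.
Qed.

Lemma corona_connected : connected C -> connected corona.
Proof.
case=> C_gt0 C_conn; split; first by rewrite card_corona double_gt0.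
have connC (x y : C) : connect corona_adj (inl x) (inl y).
  have /connectP[p xp ->] := C_conn x y; apply/connectP.
  by exists (map inl p); rewrite ?path_map ?last_map.
have to_inl (u : corona) : exists x, connect corona_adj u (inl x).
  by case: u => x; exists x => //; apply: connect1 => /=.
move=> u v; have [[x ux] [y vy]] := (to_inl u, to_inl v).
apply: connect_trans ux (connect_trans (connC x y) _).
by rewrite (sym_connect_sym corona_adj_sym).
Qed.

Lemma corona_bipartite : bipartite C -> bipartite corona.
Proof.
case=> A bipA.
(* Each leaf goes to the side opposite its neighbour. *)
exists [set u | match u with inl x => x \in A | inr x => x \notin A end].
move=> [x|x] [y|y] //=; rewrite !inE; first exact: bipA.
  by move/eqP->; case: (y \in A).
by move/eqP->; case: (y \in A).
Qed.

Lemma corona_acyclic : acyclic corona -> acyclic C.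
Proof.
move=> acyc c c_gt2 /andP[cyc_c uniq_c].
apply: (acyc (map inl c)); rewrite ?size_map //.
rewrite /ucycle map_inj_uniq ?uniq_c; last by move=> x y [].
by case: c c_gt2 cyc_c {uniq_c} => //= x p _; rewrite -map_rcons path_map => ->.
Qed.

(** The edges joining each vertex to its leaf form a perfect matching. *)
Lemma matching_number_corona : matching_number corona = #|C|.
Proof.
apply/eqP; rewrite eqn_leq; apply/andP; split.
  by rewrite -leq_double -card_corona double_matching_number.
pose spoke (x : C) : {set corona} := [set inl x; inr x].
have spoke_inj : injective spoke.
  by move=> x y /setP/(_ (inl x)); rewrite !inE eqxx /= => /esym/orP[]/eqP // -[].
rewrite -(card_imset _ spoke_inj); apply: leq_bigmax_cond.
apply/andP; split.
  apply/subsetP => _ /imsetP[x _ ->]; apply/edgeP.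
  by exists (inl x), (inr x); split => //=.
apply/trivIsetP => _ _ /imsetP[x _ ->] /imsetP[y _ ->] neq.
have {}neq : x != y by apply: contraNneq neq => ->.
rewrite -setI_eq0; apply/eqP/setP => -[z|z]; rewrite !inE /= ?orbF.
  by apply/negbTE/andP => -[/eqP[->]] /eqP[xy]; rewrite xy eqxx in neq.
by apply/negbTE/andP => -[/eqP[->]] /eqP[xy]; rewrite xy eqxx in neq.
Qed.

(** An independent set contains at most one of [inl x] and [inr x], so [base] is injective on it;
    the set of all leaves attains the bound. *)
Lemma independence_number_corona : independence_number corona = #|C|.
Proof.
apply/eqP; rewrite eqn_leq; apply/andP; split.
  apply/bigmax_leqP => A /forallP indA.
  pose base (u : corona) : C := match u with inl x | inr x => x end.
  rewrite -(@card_in_imset _ _ base) ?max_card //.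
  have nonadj u v : u \in A -> v \in A -> ~~ adj u v.
    by move=> uA; move: (indA u); rewrite uA => /forallP/(_ v)/implyP.
  by move=> [x|x] [y|y] /nonadj nx /nx /= + xy; rewrite ?xy ?eqxx.
rewrite -(card_imset predT (@inr_inj C C)); apply: leq_bigmax_cond.
apply/forallP => u; apply/implyP => /imsetP[x _ ->].
by apply/forallP => v; apply/implyP => /imsetP[y _ ->].
Qed.

End Corona.

(** * The core and the parameters of its corona *)

Section Core.

Variable s : nat.

(** The summands are the left side, the right side and the leaves; the leaf [(i, k)] hangs at the
    left vertex [i]. *)
Definition core_adj (u v : 'I_s + 'I_s + 'I_s * 'I_s) : bool :=
  match u, v with
  | inl (inl _), inl (inr _) | inl (inr _), inl (inl _) => true
  | inl (inl i), inr p | inr p, inl (inl i) => p.1 == i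
  | _, _ => false
  end.

Lemma core_adj_sym : symmetric core_adj.
Proof. by move=> [[i|i]|p] [[j|j]|q]. Qed.

Lemma core_adj_irr : irreflexive core_adj.
Proof. by move=> [[i|i]|p]. Qed.

(* [K_{s,s}] with [s] leaves attached to each vertex of the left side. *)
Definition core : sgraph := SGraph core_adj_sym core_adj_irr.

Lemma card_core : #|core| = s + s + s * s.
Proof. by rewrite !card_sum card_prod !card_ord. Qed.

Lemma deg_core (u : core) :
  deg u = match u with inl (inl _) => s + s | inl (inr _) => s | inr _ => 1 end.
Proof.
rewrite deg_sum !big_sumType /=; case: u => [[i|j]|p] /=.
- rewrite big1 // sum1_card card_ord add0n; congr (_ + _).
  rewrite -(pair_bigA _ (fun k l => (k == i : nat))) /= (bigD1 i) //= eqxx.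
  rewrite sum1_card card_ord big1 ?addn0 // => k /negPf ->.
  by rewrite big1.
- by rewrite sum1_card card_ord !big1 ?addn0.
- rewrite (bigD1 p.1) //= eqxx !big1 // => i /negPf.
  by rewrite eq_sym => ->.
Qed.

Lemma core_bipartite : bipartite core.
Proof.
exists [set u | if u is inl (inl _) then true else false].
by move=> [[i|i]|p] [[j|j]|q]; rewrite !inE.
Qed.

Lemma core_connected : 0 < s -> connected core.
Proof.
move=> s_gt0; pose o := Ordinal s_gt0.
split; first by rewrite card_core !addn_gt0 s_gt0.
have step (u v w : core) : adj u v -> connect (@adj core) v w -> connect (@adj core) u w.
  by move/connect1/connect_trans; apply.
have left_o (i : 'I_s) : connect (@adj core) (inl (inl i)) (inl (inl o)).
  (* Any right vertex is a common neighbour of all left vertices. *)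
  apply: (step _ (inl (inr o))) => //; exact: connect1.
have to_o (u : core) : connect (@adj core) u (inl (inl o)).
  case: u => [[i|j]|p]; [exact: left_o | exact: connect1 |].
  by apply: (step _ (inl (inl p.1))) => //=.
move=> u v; apply: connect_trans (to_o u) _.
by rewrite (sym_connect_sym (@adj_sym core)).
Qed.

Lemma core_not_acyclic : 1 < s -> ~ acyclic core.
Proof.
move=> s_gt1; pose o := Ordinal (ltnW s_gt1); pose l := Ordinal s_gt1.
(* Two vertices from each side, taken alternately, form a 4-cycle. *)
by move/(_ [:: inl (inl o); inl (inr o); inl (inl l); inl (inr l)]); apply.
Qed.

(** The blocks are the new leaves, the leaves of the core, the right side and the left side. The
    bracketing isolates the prefix whose sum is the number of edges. *)
Lemma perm_deg_corona_core :
  perm_eq [seq deg u | u : corona core]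
    ((nseq (s + s + s * s) 1 ++ nseq (s * s) 2) ++ nseq s s.+1 ++ nseq s (s + s).+1).
Proof.
rewrite !map_enum_sum.
rewrite (@image_const _ _ _ (s + s).+1); last by move=> i; rewrite deg_corona_inl deg_core.
rewrite (@image_const _ _ _ s.+1); last by move=> i; rewrite deg_corona_inl deg_core.
rewrite (@image_const _ _ _ 2); last by move=> p; rewrite deg_corona_inl deg_core.
rewrite !(@image_const _ _ _ 1); try by move=> u; rewrite deg_corona_inr.
rewrite card_prod !card_ord !nseqD.
by apply/permP => a; rewrite !count_cat; lia.
Qed.

Lemma num_edges_corona_core : num_edges (corona core) = 3 * (s * s) + 2 * s.
Proof.
apply: double_inj; rewrite -handshake -big_enum -(big_map _ xpredT id).
rewrite (perm_big _ perm_deg_corona_core) /= -sumnE !sumn_cat !sumn_nseq; lia.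
Qed.

Lemma annihilation_number_corona_core :
  0 < s -> annihilation_number (corona core) = 2 * (s * s) + 2 * s.
Proof.
move=> s_gt0; have := perm_deg_corona_core.
(* The first degree after the prefix is exposed to serve as [d]. *)
have -> : nseq s s.+1 ++ nseq s (s + s).+1
          = s.+1 :: (nseq s.-1 s.+1 ++ nseq s (s + s).+1).
  by rewrite -{1}(prednK s_gt0).
move=> /annihilation_number_split ->; first by rewrite size_cat !size_nseq; lia.
  (* The sequence becomes five constant blocks followed by an empty tail; [s_gt0] gives
     [2 <= s.+1]. *)
  rewrite -[_ :: _]/(nseq 1 s.+1 ++ _) -[nseq s (s + s).+1]cats0 -!catA.
  do 5?[apply: sorted_nseq_cat]; rewrite ?all_cat ?all_nseq //=; lia.
by rewrite num_edges_corona_core sumn_cat !sumn_nseq; lia.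
Qed.

End Core.

(** * The infinite family *)

Local Open Scope ring_scope.

Theorem proposition4p6 (R : rcfType) :
  exists G : nat -> sgraph,
    (forall i j : nat, i <> j -> ~ isomorphic (G i) (G j)) /\
    (forall i : nat,
       [/\ connected (G i), bipartite (G i), ~ is_tree (G i)
         & (annihilation_number (G i))%:R - (independence_number (G i))%:R
           = 2 + (matching_number (G i))%:R
             - 2 * Num.sqrt (1 + (matching_number (G i))%:R) :> R]).
Proof.
(* The shift ensures [s >= 2], which the 4-cycle requires. *)
exists (fun i => corona (core i.+2)); split.
  (* The order [2 * (s * s + 2 * s)] is strictly increasing in [s], so it separates the graphs. *)
  by move=> i j ij /isomorphic_card; rewrite !card_corona !card_core; nia.
move=> i; split.
- exact/corona_connected/core_connected.
- exact/corona_bipartite/core_bipartite.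
- by case=> _ /corona_acyclic; apply: core_not_acyclic.
rewrite annihilation_number_corona_core // independence_number_corona.
rewrite matching_number_corona card_core; move: i.+2 => s.
have -> : 1 + (s + s + s * s)%:R = (s%:R + 1) ^+ 2 :> R.
  by rewrite !natrD natrM; ring.
rewrite sqrtr_sqr ger0_norm ?addr_ge0 ?ler0n //.
(* With the root equal to [s + 1], both sides are [s * s]. *)
by rewrite !natrD !natrM; ring.
Qed.
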